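(* Suppose consecutive primes satisfy $\sqrt{p_n} - \sqrt{p_{n-1}} = O(1)$, i.e. there is a constant $C>0$ with $\sqrt{p_n} - \sqrt{p_{n-1}} < C$ for all $n \ge 2$. Then there exists a positive integer $M$ such that for every integer $m > M$ there is a prime number $p$ with $m^3 < p < (m+1)^3$.
   Context: $p_1 = 2 < p_2 = 3 < p_3 < \cdots$ denotes the increasing enumeration of all prime numbers, so $p_n$ is the $n$-th prime. *)

(* Defs.v *)
From mathcomp Require Import all_boot.

Set Implicit Arguments.
Unset Strict Implicit.
Unset Printing Implicit Defensive.

Lemma ex_prime_above (m : nat) : exists p, prime p && (m < p).
Proof. by have [p lt_mp pr_p] := prime_above m; exists p; rewrite pr_p. Qed.

Definition next_prime (m : nat) : nat := ex_minn (ex_prime_above m).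

(* Indexed from 1, so that nth_prime 1 = 2; nth_prime 0 = 0 is a dummy value. *)
Fixpoint nth_prime (n : nat) : nat :=
  if n is n'.+1 then next_prime (nth_prime n') else 0.

Lemma prime_nth_prime n : 0 < n -> prime (nth_prime n).
Proof.
by case: n => // n _ /=; rewrite /next_prime; case: ex_minnP => p /andP[].
Qed.

Lemma nth_prime_ltS n : nth_prime n < nth_prime n.+1.
Proof. by rewrite /= /next_prime; case: ex_minnP => p /andP[]. Qed.

Lemma nth_prime_surj p : prime p -> exists2 n, 0 < n & nth_prime n = p.
Proof.
move=> pr_p.
have le_n n : n <= nth_prime n.
  by elim: n => // n IHn; apply: leq_ltn_trans IHn (nth_prime_ltS n).
have ex_n : exists n, p <= nth_prime n by exists p.
case: (ex_minnP ex_n) => -[|n] p_le n_min.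
  by move: p_le; rewrite leqn0 => /eqP p0; rewrite p0 in pr_p.
exists n.+1 => //; apply/eqP; rewrite eqn_leq p_le andbT /= /next_prime.
case: ex_minnP => q _; apply; rewrite pr_p /= ltnNge.
by apply/negP => /n_min; rewrite ltnn.
Qed.

Lemma nth_prime1 : nth_prime 1 = 2.
Proof.
rewrite /= /next_prime; case: ex_minnP => q /andP[pr_q _] q_min.
by apply/eqP; rewrite eqn_leq q_min // prime_gt1.
Qed.

(* Main.v *)
Require Import Defs.
From mathcomp Require Import all_boot all_order all_algebra.
From mathcomp Require Import reals.
From mathcomp Require Import ring lra.

(** If no prime lies strictly between m^3 and (m+1)^3, the consecutive primes
    around m^3 have square roots at least (m+1)^(3/2) - m^(3/2) apart, so the
    hypothesis gives 3 m^2 + 3 m + 1 < C^2 + 2 C m^(3/2).  For m > C^2 the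
    right-hand side is less than m + 2 m^2, because (C m^(3/2))^2 < m^4. *)

Import Order.TTheory GRing.Theory Num.Theory.
Local Open Scope ring_scope.

Lemma consecutive_primes_around (k : nat) : (2 <= k)%N ->
  exists n, [/\ (2 <= n)%N, (nth_prime n.-1 <= k)%N & (k < nth_prime n)%N].
Proof.
move=> k_ge2.
have ex_n : exists n, (k < nth_prime n)%N.
  have [p lt_kp pr_p] := prime_above k.
  by have [n _ def_p] := nth_prime_surj pr_p; exists n; rewrite def_p.
(* The least such index works: minimality bounds the preceding prime by [k]. Index 0 fails by its
   dummy value 0, index 1 because [k] is at least 2. *)
case: (ex_minnP ex_n) => -[|[|n]] k_lt n_min; first by [].
  by move: k_lt; rewrite nth_prime1 ltnNge k_ge2.
exists n.+2; split=> //; rewrite leqNgt; apply/negP => /n_min.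
by rewrite ltnn.
Qed.

Lemma sqrt_cube_gap (R : rcfType) (C x : R) : 0 < C -> C ^+ 2 < x ->
  C <= Num.sqrt ((x + 1) ^+ 3) - Num.sqrt (x ^+ 3).
Proof.
move=> C_gt0 ltCx.
have x_gt0 : 0 < x by apply: le_lt_trans ltCx; exact: sqr_ge0.
have [C_ge0 x_ge0] := (ltW C_gt0, ltW x_gt0).
set s := Num.sqrt (x ^+ 3).
have s_ge0 : 0 <= s by exact: sqrtr_ge0.
have def_s : s ^+ 2 = x ^+ 3 by rewrite sqr_sqrtr // exprn_ge0.
have ltCs : C * s <= x ^+ 2.
  rewrite -(ler_pXn2r (ltn0Sn 1)) ?nnegrE ?exprn_ge0 ?mulr_ge0 //.
  rewrite exprMn def_s -exprM exprS; apply: ltW.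
  by rewrite ltr_pM2r // exprn_gt0.
(* Writing [C + s] as the root of its square leaves a polynomial inequality under the roots. *)
rewrite lerBrDr -[C + s]ger0_norm ?addr_ge0 // -sqrtr_sqr ler_wsqrtr //.
have -> : (C + s) ^+ 2 = C ^+ 2 + 2 * (C * s) + x ^+ 3 by rewrite -def_s; ring.
have -> : (x + 1) ^+ 3 = x ^+ 3 + 3 * x ^+ 2 + 3 * x + 1 by ring.
have := sqr_ge0 x; lra.
Qed.

Theorem theorem7 (R : realType) :
  (exists C : R, 0 < C /\
     forall n : nat, (2 <= n)%N ->
       Num.sqrt (nth_prime n)%:R - Num.sqrt (nth_prime n.-1)%:R < C) ->
  exists M : nat, (0 < M)%N /\
    forall m : nat, (M < m)%N ->
      exists p : nat, prime p /\ (m ^ 3 < p < m.+1 ^ 3)%N.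
Proof.
move=> [C [C_gt0 gapC]].
(* The successor makes [M] positive, hence [m] at least 2. *)
exists (Num.bound (C ^+ 2)).+1; split=> // m ltMm.
have ltCm : C ^+ 2 < m%:R.
  apply: lt_trans (archi_boundP (sqr_ge0 C)) _.
  by rewrite ltr_nat; apply: ltnW.
have m_ge2 : (2 <= m)%N by apply: leq_ltn_trans ltMm.
have m3_ge2 : (2 <= m ^ 3)%N.
  by rewrite (leq_trans m_ge2) // expnS leq_pmulr // expn_gt0 ltnW.
have [n [n_ge2 le_m3 lt_m3]] := consecutive_primes_around _ m3_ge2.
exists (nth_prime n); split; first by apply: prime_nth_prime; apply: ltnW.
rewrite lt_m3 ltnNge; apply/negP => le_p.
(* Both cubes now lie between the two consecutive primes, so the gap of the primes' roots is at
   least that of the cubes' roots. *)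
have := lt_le_trans (gapC n n_ge2) (sqrt_cube_gap _ _ _ C_gt0 ltCm).
apply/negP; rewrite -leNgt lerB // ler_wsqrtr //.
  by rewrite natr1 -natrX ler_nat.
by rewrite -natrX ler_nat.
Qed.
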